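(* Let $G$ be a 2-step nilpotent Lie group equipped with an invariant HKT structure $(\{J_i\}_{i=1,2,3}, g)$, and let $\mathfrak g$ be its Lie algebra. Then the hypercomplex structure $\{J_i\}_{i=1,2,3}$ is abelian, i.e. $[J_iX,J_iY]=[X,Y]$ for all $X,Y\in\mathfrak g$ and $i=1,2,3$.
   Context: A hypercomplex structure on a (finite-dimensional real) Lie algebra $\mathfrak g$ is a triple of endomorphisms $\{J_i\}_{i=1,2,3}$ of $\mathfrak g$ with $J_i^2=-I$ ($i=1,2,3$), $J_1J_2=-J_2J_1=J_3$, such that for each $i$ the Nijenhuis tensor vanishes: $N_i(X,Y)=J_i([X,Y]-[J_iX,J_iY])-([J_iX,Y]+[X,J_iY])=0$ for all $X,Y\in\mathfrak g$. An HKT structure $(\{J_i\}_{i=1,2,3},g)$ on $\mathfrak g$ is a hypercomplex structure together with an inner product $g$ on $\mathfrak g$ such that (a) $g(X,Y)=g(J_1X,J_1Y)=g(J_2X,J_2Y)=g(J_3X,J_3Y)$ for all $X,Y\in\mathfrak g$; and (b) for all $X,Y,Z\in\mathfrak g$ the quantity $$g([J_iX,J_iY],Z)+g([J_iY,J_iZ],X)+g([J_iZ,J_iX],Y)$$ is the same for $i=1,2,3$. An invariant HKT structure on a Lie group $G$ is one obtained from an HKT structure on its Lie algebra by left translation of the $J_i$ and $g$. A Lie algebra $\mathfrak n$ is $k$-step nilpotent if $\mathfrak n^k=0$ and $\mathfrak n^{k-1}\neq 0$, where $\mathfrak n^0=\mathfrak n$, $\mathfrak n^i=[\mathfrak n^{i-1},\mathfrak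 n]$; a Lie group is $k$-step nilpotent if its Lie algebra is. *)

(* Defs.v *)
From HB Require Import structures.
From mathcomp Require Import all_boot all_order all_algebra.
From mathcomp Require Import reals.

Set Implicit Arguments.
Unset Strict Implicit.
Unset Printing Implicit Defensive.

Import Order.TTheory GRing.Theory Num.Theory.

Local Open Scope ring_scope.

HB.mixin Record Vector_isLieAlgebra (R : fieldType) g of Vector R g := {
  lie : {bilinear g -> g -> g};
  lie_xx : forall X : g, lie X X = 0;
  lie_jacobi : forall X Y Z : g,
    lie X (lie Y Z) + lie Y (lie Z X) + lie Z (lie X Y) = 0
}.

#[short(type="lieAlgType")]
HB.structure Definition LieAlgebra (R : fieldType) :=
  {g of Vector_isLieAlgebra R g & Vector R g}.

Notation "[ 'lie' X , Y ]" := (lie X Y)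
  (at level 0, X, Y at level 99, format "[ 'lie'  X ,  Y ]") : ring_scope.

Section LowerCentralSeries.

Context {R : fieldType} {g : lieAlgType R}.

Implicit Types U V W : {vspace g}.

(* The span of all brackets [lie u, w] with u \in U and w \in W; by
   bilinearity, bases of U and W suffice (see memv_lie_prod and
   lie_prod_subvP). *)
Definition lie_prod U W : {vspace g} :=
  <<[seq [lie u, w] | u <- vbasis U, w <- vbasis W]>>%VS.

Lemma memv_lie_prod U W (u w : g) :
  u \in U -> w \in W -> [lie u, w] \in lie_prod U W.
Proof.
move=> uU wW; rewrite (coord_vbasis uU) (coord_vbasis wW).
rewrite linear_sumlz; apply: memv_suml => i _.
rewrite linear_sumr; apply: memv_suml => j _.
rewrite linearZl_LR linearZr_LR /=; apply/memvZ/memvZ/memv_span.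
by apply/allpairsP; exists ((vbasis U)`_i, (vbasis W)`_j) => /=;
  rewrite !mem_nth ?size_tuple.
Qed.

Lemma lie_prod_subvP U W V :
  reflect (forall u w, u \in U -> w \in W -> [lie u, w] \in V)
          (lie_prod U W <= V)%VS.
Proof.
apply: (iffP idP) => [sUWV u w uU wW | UWV].
  exact: (subvP sUWV _ (memv_lie_prod uU wW)).
apply/span_subvP => _ /allpairsP[[u w] /= [uU wW ->]].
by apply: UWV; apply: vbasis_mem.
Qed.

Definition lower_central (k : nat) : {vspace g} :=
  iter k (fun U => lie_prod U fullv) fullv.

End LowerCentralSeries.

(* With k = 0 the two conditions contradict each other, so that no Lie algebra
   (not even the zero one) is 0-step nilpotent. *)
Definition step_nilpotent {R : fieldType} (k : nat) (g : lieAlgType R) : Prop :=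
  @lower_central R g k = 0%VS /\ @lower_central R g k.-1 <> 0%VS.

Section HyperKahlerTorsion.

Context {R : realType} {g : lieAlgType R}.

Definition nijenhuis (J : 'End(g)) (X Y : g) : g :=
  J ([lie X, Y] - [lie J X, J Y]) - ([lie J X, Y] + [lie X, J Y]).

(* J_1, J_2, J_3 are J 0, J 1, J 2, with 0, 1, 2 : 'I_3. *)
Record is_hypercomplex (J : 'I_3 -> 'End(g)) : Prop := IsHypercomplex {
  hypercomplex_sqr : forall i, (J i \o J i)%VF = - \1%VF;
  hypercomplex_mul : (J 0 \o J 1)%VF = J 2;
  hypercomplex_anti : - (J 1 \o J 0)%VF = J 2;
  hypercomplex_integrable : forall i X Y, nijenhuis (J i) X Y = 0
}.

(* Up to sign, the torsion 3-form of the Bismut connection of the Hermitian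
   structure (J, h). *)
Definition bismut_torsion (h : {dot g for idfun}) (J : 'End(g)) (X Y Z : g) : R :=
  h [lie J X, J Y] Z + h [lie J Y, J Z] X + h [lie J Z, J X] Y.

(* Over the reals, {dot g for idfun} is the type of inner products on g:
   bilinear, symmetric and positive definite forms. *)
Record is_HKT (J : 'I_3 -> 'End(g)) (h : {dot g for idfun}) : Prop := IsHKT {
  HKT_hypercomplex : is_hypercomplex J;
  HKT_hermitian : forall i X Y, h X Y = h (J i X) (J i Y);
  HKT_torsion : forall i j X Y Z,
    bismut_torsion h (J i) X Y Z = bismut_torsion h (J j) X Y Z
}.

Definition is_abelian_hypercomplex (J : 'I_3 -> 'End(g)) : Prop :=
  forall i X Y, [lie J i X, J i Y] = [lie X, Y].

End HyperKahlerTorsion.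

(* Main.v *)
Require Import Defs.
From mathcomp Require Import all_boot all_order all_algebra.
From mathcomp Require Import reals.

(** Let z be the centre of g.  Since g is 2-step nilpotent, every bracket
    lies in z.  If W is in z, integrability of J_i reads
    [J_i W, J_i Y] = J_i [J_i W, Y], so most terms of the torsion identity vanish
    as soon as some of its arguments are central.

    The heart of the proof is that z is stable under each J_i.  This goes up
    in three steps, each of which ends by exhibiting a central vector of norm
    zero, which is where positivity of the metric enters:
    - if W and J_a W are central, then so are all J_i W
      ([central_quaternionic]);
    - hence, for W central, all values of ad (J_a W) lie in the largest
      hypercomplex subspace of z; testing the torsion identity on that subspace
      shows that [J_a W, J_a Y] does not depend on a
      ([central_bracket_indep]);
    - comparing the torsion on (W, J_a U, Y) for two indices, with W and U
      central, then leaves the single term h [J_c U, Y'] W = 0; the choice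
      W = [J_c U, Y'] gives [J_c U, Y'] = 0 ([central_J]).

    Once J_i z is contained in z, the torsion on (X, Y, W) with W central is
    just h [J_i X, J_i Y] W, so [J_i X, J_i Y] does not depend on i; feeding
    J_1 J_2 = J_3 into this turns it into [X, Y]. *)

Set Implicit Arguments.
Unset Strict Implicit.
Unset Printing Implicit Defensive.

Import Order.TTheory GRing.Theory Num.Theory.

Local Open Scope ring_scope.

Section Central.

Context {R : fieldType} {g : lieAlgType R}.
Implicit Types U W X Y : g.

Lemma lieC X Y : [lie X, Y] = - [lie Y, X].
Proof.
apply/eqP; rewrite -addr_eq0; apply/eqP.
have := lie_xx (X + Y).
by rewrite linearDl !linearDr /= !lie_xx add0r addr0.
Qed.

Definition central W := forall Y, [lie W, Y] = 0.

Lemma centralr W Y : central W -> [lie Y, W] = 0.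
Proof. by move=> cW; rewrite lieC cW oppr0. Qed.

Lemma centralN W : central W -> central (- W).
Proof. by move=> cW Y; rewrite linearNl /= cW oppr0. Qed.

Lemma centralB U W : central U -> central W -> central (U - W).
Proof. by move=> cU cW Y; rewrite linearBl /= cU cW subrr. Qed.

Lemma central_lie X Y : step_nilpotent 2 g -> central [lie X, Y].
Proof.
case=> /= g2_0 _ Z; apply/eqP; rewrite -memv0.
suff : [lie [lie X, Y], Z] \in lower_central 2 by rewrite /lower_central /= g2_0.
apply: memv_lie_prod; last exact: memvf.
by apply: memv_lie_prod; apply: memvf.
Qed.

End Central.

Section Hypercomplex.

Context {R : realType} {g : lieAlgType R} {J : 'I_3 -> 'End(g)}.
Hypothesis J_hypercomplex : is_hypercomplex J.
Implicit Types (i : 'I_3) (W X Y : g).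

Lemma JK i X : J i (J i X) = - X.
Proof.
by rewrite -comp_lfunE (hypercomplex_sqr J_hypercomplex) opp_lfunE id_lfunE.
Qed.

(** The relations J_1 J_2 = J_3 = - J_2 J_1 are invariant under cyclic shifts
    of the indices; addition in ['I_3] is modulo 3. *)
Lemma J_cyclic i X :
  [/\ J i (J (i + 1) X) = J (i + 2) X, J (i + 1) (J (i + 2) X) = J i X
    & J (i + 2) (J (i + 1) X) = - J i X].
Proof.
have J01 Y : J 0 (J 1 Y) = J 2 Y.
  by rewrite -comp_lfunE (hypercomplex_mul J_hypercomplex).
have J10 Y : J 1 (J 0 Y) = - J 2 Y.
  by rewrite -(hypercomplex_anti J_hypercomplex) opp_lfunE opprK comp_lfunE.
have J21 Y : J 2 (J 1 Y) = - J 0 Y by rewrite -J01 JK linearN.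
have J12 Y : J 1 (J 2 Y) = J 0 Y.
  by rewrite -J01 J10 J21 opprK.
have J02 Y : J 0 (J 2 Y) = - J 1 Y by rewrite -J01 JK.
have J20 Y : J 2 (J 0 Y) = J 1 Y.
  by rewrite -[J 2 _]opprK -J10 JK linearN opprK.
have I3 : [\/ i = 0, i = 1 | i = 2].
  by case: i => [[|[|[|//]]] ?];
    [constructor 1 | constructor 2 | constructor 3]; apply: val_inj.
have E12 : 1 + 1 = 2 :> 'I_3 by apply: val_inj.
have E21 : 2 + 1 = 0 :> 'I_3 by apply: val_inj.
have E22 : 2 + 2 = 1 :> 'I_3 by apply: val_inj.
have E3 : 1 + 2 = 0 :> 'I_3 by apply: val_inj.
by case: I3 => ->; rewrite ?add0r ?E12 ?E21 ?E22 ?E3; split.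
Qed.

Lemma lie_JJ i X Y :
  [lie J i X, J i Y] = [lie X, Y] + J i ([lie J i X, Y] + [lie X, J i Y]).
Proof.
have /eqP := hypercomplex_integrable J_hypercomplex i X Y.
by rewrite subr_eq0 => /eqP <-; rewrite JK opprB addrC subrK.
Qed.

Lemma lie_JJ_central i W Y :
  central W -> [lie J i W, J i Y] = J i [lie J i W, Y].
Proof. by move=> cW; rewrite lie_JJ !cW add0r addr0. Qed.

(** The J_i are invertible, so centrality may be tested on their images. *)
Lemma central_lieJ i W : (forall Y, [lie W, J i Y] = 0) -> central W.
Proof.
by move=> W0 Y; rewrite -[Y]opprK -(JK i Y) -linearN W0.
Qed.

End Hypercomplex.

Section HKT.

Context {R : realType} {g : lieAlgType R}.
Context {J : 'I_3 -> 'End(g)} {h : {dot g for idfun}}.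
Hypothesis g_2step : step_nilpotent 2 g.
Hypothesis J_HKT : is_HKT J h.
Implicit Types (a b i j : 'I_3) (U W X Y : g).

Let J_hypercomplex : is_hypercomplex J := HKT_hypercomplex J_HKT.
Let lie_central X Y : central [lie X, Y] := central_lie X Y g_2step.

Lemma dot_eq0 X : h X X = 0 -> X = 0.
Proof.
move=> hX0; apply/eqP/negP => /negP /(neq0_dnorm_gt0 (s := h)).
by rewrite hX0 ltxx.
Qed.

Lemma dot0l X : h 0 X = 0.
Proof. by rewrite -(subrr X) linearBl /= subrr. Qed.

(** For W with W and J_a W central, put X = J_b [J_b W, Y], b = a + 1.  The
    integrability of the third structure makes J_a X central as well, so the
    torsion on (X, W, Y) is zero when computed with J_a, and h X X when
    computed with J_b. *)
Lemma central_quaternionic_next a W :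
  central W -> central (J a W) -> central (J (a + 1) W).
Proof.
move=> cW cJW Y; set b := a + 1; set V := [lie J b W, Y].
have cV : central V by exact: lie_central.
have [JaJb _ _] := J_cyclic J_hypercomplex a V.
have J_V : J (a + 2) V = [lie J b W, J (a + 2) Y].
  have := lie_JJ J_hypercomplex (a + 2) (J b W) Y.
  have [_ _ ->] := J_cyclic J_hypercomplex a W.
  rewrite !(centralN cJW) add0r -/V => /esym/eqP.
  by rewrite addr_eq0 => /eqP ->; rewrite linearN /= JK // opprK.
set X := J b V.
have X_lie : X = [lie J b W, J b Y].
  by rewrite lie_JJ_central.
have cX : central X by rewrite X_lie.
have cJX : central (J a X) by rewrite JaJb J_V.
have JbX : J b X = - V by rewrite /X JK.
have := HKT_torsion J_HKT a b X W Y.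
rewrite /bismut_torsion cJX cJW (centralr _ cJX) !dot0l !add0r.
rewrite JbX (centralN cV) (centralr _ (centralN cV)) -X_lie.
rewrite !dot0l add0r addr0 => /esym /dot_eq0 X0.
by rewrite -[V]opprK -JbX X0 linear0 oppr0.
Qed.

Lemma central_quaternionic a W :
  central W -> central (J a W) -> forall i, central (J i W).
Proof.
move=> cW cJW i.
have cJ1W := central_quaternionic_next cW cJW.
have cJ2W : central (J (a + 1 + 1) W) by exact: central_quaternionic_next.
have : [\/ i = a, i = a + 1 | i = a + 1 + 1].
  case: a {cJW cJ1W cJ2W} => [[|[|[|//]]] ?];
  by case: i => [[|[|[|//]]] ?];
    [constructor 1 + constructor 2 + constructor 3; by apply: val_inj ..].
by case=> ->.
Qed.

Lemma central_J_lie a i W Y : central W -> central (J i [lie J a W, Y]).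
Proof.
move=> cW; apply: (central_quaternionic (a := a)) => //.
by rewrite -lie_JJ_central.
Qed.

(** The difference X of the two sides lies in the hypercomplex part of the
    centre, where the torsion on (X, W, Y) is h [J_i W, J_i Y] X. *)
Lemma central_bracket_indep a b W Y :
  central W -> [lie J a W, J a Y] = [lie J b W, J b Y].
Proof.
move=> cW; apply/eqP; rewrite -subr_eq0; apply/eqP/dot_eq0.
set X := (Z in h Z Z); rewrite {1}/X.
have cJX i : central (J i X).
  by rewrite linearB; apply: centralB; apply: central_J_lie.
have torsionX i : bismut_torsion h (J i) X W Y = h [lie J i W, J i Y] X.
  by rewrite /bismut_torsion cJX (centralr _ (cJX i)) !dot0l add0r addr0.
by rewrite linearBl /= -!torsionX (HKT_torsion J_HKT a b) subrr.
Qed.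

(** The torsions of J_a and J_b are compared on (V, J_a W, Y) with V central.
    By [central_bracket_indep], [J_k V, J_k (J_a W)] does not depend on k, so it
    equals [J_a V, - W] = 0, and the terms in [J_k Y, J_k V] agree for k = a and
    k = b; only h [J_b J_a W, J_b Y] V is left, and V is chosen so that this is
    a squared norm. *)
Lemma central_J i W : central W -> central (J i W).
Proof.
move=> cW; pose a := i + 2; pose b := i + 1.
have [_ <- _] := J_cyclic J_hypercomplex i W.
apply: (central_lieJ J_hypercomplex (i := b)) => Y.
rewrite -/a -/b; set V := [lie J b (J a W), J b Y].
have cV : central V by exact: lie_central.
have JV_JW k : [lie J k V, J k (J a W)] = 0.
  by rewrite (central_bracket_indep k a) // JK // (centralr _ (centralN cW)).
have := HKT_torsion J_HKT a b V (J a W) Y.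
rewrite /bismut_torsion !JV_JW !dot0l !add0r JK // (centralN cW) dot0l add0r.
rewrite (lieC (J a Y)) (central_bracket_indep a b) // -lieC.
by rewrite -[LHS]add0r => /addIr/esym/dot_eq0.
Qed.

(** Since J_k W is central with W, the torsion of J_k on (X, Y, W) is
    h [J_k X, J_k Y] W; W is the difference of the two sides. *)
Lemma lie_JJ_indep i j X Y : [lie J i X, J i Y] = [lie J j X, J j Y].
Proof.
apply/eqP; rewrite -subr_eq0; apply/eqP/dot_eq0.
set W := (Z in h Z Z); rewrite {1}/W.
have cW : central W by apply: centralB.
have torsionW k : bismut_torsion h (J k) X Y W = h [lie J k X, J k Y] W.
  have cJW := central_J k cW.
  by rewrite /bismut_torsion cJW (centralr _ cJW) !dot0l !addr0.
by rewrite linearBl /= -!torsionW (HKT_torsion J_HKT i j) subrr.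
Qed.

End HKT.

Theorem theorem3p1 (R : realType) (g : lieAlgType R)
    (J : 'I_3 -> 'End(g)) (h : {dot g for idfun}) :
  step_nilpotent 2 g -> is_HKT J h -> is_abelian_hypercomplex J.
Proof.
move=> g_2step J_HKT i X Y; have J_hyp := HKT_hypercomplex J_HKT.
(* J_i = J_(i+1) J_(i+2), whose outer factor may be traded for J_(i+2). *)
have [_ <- _] := J_cyclic J_hyp i X.
have [_ <- _] := J_cyclic J_hyp i Y.
rewrite (lie_JJ_indep g_2step J_HKT (i + 1) (i + 2)) !JK //.
by rewrite linearNl linearNr opprK.
Qed.
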